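(* Every amenable left-orderable group is locally indicable.
   Context: All groups are discrete. A group $\Gamma$ is amenable iff for every continuous action of $\Gamma$ on a compact Hausdorff space $X$, there is a $\Gamma$-invariant (Borel) probability measure on $X$. A left-invariant order on $\Gamma$ is a (strict) total order $\prec$ on $\Gamma$ such that, for all $\gamma,\lambda_1,\lambda_2\in\Gamma$, if $\lambda_1\prec\lambda_2$ then $\gamma\lambda_1\prec\gamma\lambda_2$; $\Gamma$ is left orderable iff it admits a left-invariant order. A group is locally indicable iff each of its nontrivial finitely generated subgroups has an infinite cyclic quotient (i.e. a surjective homomorphism onto $\mathbb{Z}$). *)

(* Defs.v *)
From mathcomp Require Import all_boot all_order all_algebra.
From mathcomp Require Import all_classical all_reals all_analysis.

Set Implicit Arguments.
Unset Strict Implicit.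
Unset Printing Implicit Defensive.

Local Open Scope classical_set_scope.
Local Open Scope group_scope.

(* Left action of the discrete group G on X: the action map G * X -> X is
   jointly continuous, G carrying the discrete topology. *)
Definition continuous_action (G : groupType) (X : topologicalType)
    (act : G -> X -> X) : Prop :=
  [/\ forall x, act 1 x = x,
      forall g h x, act (g * h) x = act g (act h x)
    & continuous (fun p : discrete_topology G * X => act p.1 p.2)].

(* X ranges over pointed spaces because the empty space carries an action of
   every group but no probability measure.  Measures live on the Borel
   sigma-algebra, generated by the open sets; no regularity is required. *)
Definition amenable (R : realType) (G : groupType) : Prop :=
  forall (X : ptopologicalType) (act : G -> X -> X),
    compact [set: X] -> hausdorff_space X -> continuous_action act ->
    exists mu : probability (g_sigma_algebraType (@open X)) R,
      forall (g : G) (A : set (g_sigma_algebraType (@open X))),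
        measurable A -> mu (act g @^-1` A) = mu A.

Definition left_invariant_order (G : groupType) (lt : rel G) : Prop :=
  [/\ irreflexive lt,
      transitive lt,
      forall x y, x != y -> lt x y || lt y x
    & forall g x y, lt x y -> lt (g * x) (g * y)].

Definition left_orderable (G : groupType) : Prop :=
  exists lt : rel G, left_invariant_order lt.

Definition generated_by (G : groupType) (s : seq G) (H : {pred G}) : Prop :=
  {subset s <= H} /\
  forall K : {pred G}, group_closed K -> {subset s <= K} -> {subset H <= K}.

(* Homomorphisms H -> Z are represented by total functions on G that are
   additive on H; their values outside H are irrelevant. *)
Definition has_infinite_cyclic_quotient (G : groupType) (H : {pred G}) : Prop :=
  exists2 phi : G -> int,
    {in H &, {morph phi : x y / (x * y)%g >-> (x + y)%R}}
    & forall n : int, exists2 h, h \in H & phi h = n.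

Definition locally_indicable (G : groupType) : Prop :=
  forall H : {pred G},
    group_closed H ->
    (exists s : seq G, generated_by s H) ->
    (exists2 h, h \in H & h != 1) ->
    has_infinite_cyclic_quotient H.

(* Main.v *)
From HB Require Import structures.
Require Import Defs.
From mathcomp Require Import all_boot all_order all_algebra.
From mathcomp Require Import all_classical all_reals all_analysis.
From mathcomp Require Import zify.
Set Implicit Arguments.
Unset Strict Implicit.
Unset Printing Implicit Defensive.
Import Order.TTheory GRing.Theory Num.Theory.
Local Open Scope classical_set_scope.
Local Open Scope group_scope.

(** The left-invariant orders on [G] form a compact Hausdorff space on which [G]
    acts by translating on the right.  If [G] is amenable this space carries an
    invariant probability measure, and Poincare recurrence
    ([poincare_recurrence]) applies to every element [b] of [G]: for almost
    every order in which [1 < a], some right translate by a positive power of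
    [b] again satisfies it, that is, [b ^+ n < a * b ^+ n] for some [n > 0].
    A finitely generated subgroup [H] is countable, so a single order has this
    property for all [a] and [b] in [H] ([amenable_recurrent_order]).  When
    moreover [1 < b], then [b <= b ^+ n < a * b ^+ n]: the order is Conradian
    on [H].

    The rest is the theorem that a nontrivial finitely generated group with a
    Conradian order maps onto the integers ([conradian_character]).  In a
    Conradian order the elements lying between two powers of a fixed positive
    [g] form a subgroup ([power_boundedV], [power_boundedM]).  For [f] the
    largest of the generators and their inverses, this subgroup is everything
    when [g = f].  Call [x] big if one of its powers exceeds [f].  Bigness is
    invariant under conjugation ([big_conj]) and the elements [x] such that
    neither [x] nor its inverse is big form a proper normal subgroup [N], with
    a torsion-free quotient; the order induces an Archimedean bi-invariant
    order on this quotient, and the argument of Hoelder shows that the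
    quotient is abelian ([Nbig_commg]).  A nontrivial finitely generated
    torsion-free abelian group has a nonzero homomorphism to the integers
    ([torsion_free_character]), which is made surjective by dividing by the
    positive generator of its image ([surjective_character]). *)

(** * Conradian left-invariant orders *)
Section LeftOrder.
Variables (G : groupType) (lt : rel G).
Hypothesis ltG : left_invariant_order lt.
Local Notation "x <o y" := (lt x y) (at level 70).
Local Notation "x <=o y" := (~~ lt y x) (at level 70).
Implicit Types x y z a b g h : G.

Lemma lto_irr x : (x <o x) = false.
Proof. by case: ltG => irr _ _ _; exact: irr. Qed.

Lemma lto_trans y x z : x <o y -> y <o z -> x <o z.
Proof. by case: ltG => _ tr _ _; exact: tr. Qed.

Lemma ltoM2l z x y : (z * x <o z * y) = (x <o y).
Proof.
case: ltG => _ _ _ inv; apply/idP/idP => [h|]; last exact: inv.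
by rewrite -(mulKg z x) -(mulKg z y); exact: inv.
Qed.

Lemma ltoW x y : x <o y -> x <=o y.
Proof. by move=> xy; apply/negP => /(lto_trans xy); rewrite lto_irr. Qed.

Lemma leo_eqVlt x y : x <=o y -> x = y \/ x <o y.
Proof.
case: ltG => _ _ tot _; have [->|/tot/orP[xy|->//]] := eqVneq x y; first by left.
by right.
Qed.

Lemma leo_lt_trans y x z : x <=o y -> y <o z -> x <o z.
Proof. by move=> /leo_eqVlt[->//|]; exact: lto_trans. Qed.

Lemma lto_le_trans y x z : x <o y -> y <=o z -> x <o z.
Proof. by move=> xy /leo_eqVlt[<-//|]; exact: lto_trans. Qed.

Lemma leo_trans y x z : x <=o y -> y <=o z -> x <=o z.
Proof. by move=> xy yz; apply/negP => /(leo_lt_trans yz); exact/negP. Qed.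

Lemma leo_refl x : x <=o x. Proof. by rewrite lto_irr. Qed.

Lemma lto1V x : (1 <o x^-1) = (x <o 1).
Proof. by rewrite -(ltoM2l x) mulg1 mulgV. Qed.

Lemma ltoV1 x : (x^-1 <o 1) = (1 <o x).
Proof. by rewrite -lto1V invgK. Qed.

Lemma lto1M x y : 1 <o x -> 1 <o y -> 1 <o x * y.
Proof. by move=> x1 y1; apply: (lto_trans x1); rewrite -[X in X <o _]mulg1 ltoM2l. Qed.

Lemma expo_ge1 g n : 1 <o g -> 1 <=o g ^+ n.
Proof.
move=> g1; elim: n => [|n IHn]; first exact: leo_refl.
by rewrite expgS; apply: ltoW; apply: (lto_le_trans g1);
  rewrite -[X in _ <o X]mulg1 ltoM2l.
Qed.

Lemma expo_le1 g n : g <=o 1 -> g ^+ n <=o 1.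
Proof.
move=> g1; elim: n => [|n IHn]; first exact: leo_refl.
by rewrite expgS; apply: leo_trans g1; rewrite -[X in X <o _]mulg1 ltoM2l.
Qed.

Lemma expo_le g m n : 1 <o g -> (m <= n)%N -> g ^+ m <=o g ^+ n.
Proof.
move=> g1 /subnKC <-; rewrite expgnDr -[X in _ <o X]mulg1 ltoM2l.
exact: expo_ge1.
Qed.

Lemma expVo_le g m n : 1 <o g -> (m <= n)%N -> g ^- n <=o g ^- m.
Proof.
move=> g1 /subnK <-; rewrite expgnDr invgM -[X in X <o _]mulg1 ltoM2l lto1V.
exact: expo_ge1.
Qed.

Definition conradian :=
  forall a b, 1 <o a -> 1 <o b -> exists n, b <o a * b ^+ n.

Hypothesis conrad : conradian.

(** If [a * b * b <= b], then [h := a * b] satisfies [h * b <= b], hence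
    [h ^+ n <= h ^+ n * b <= b] for all [n], and [a * h ^+ n <= a * b = h]
    contradicts the Conradian property of [a] and [h]. *)
Lemma conrad2 a b : 1 <o a -> 1 <o b -> b <o a * b * b.
Proof.
move=> a1 b1; apply: contraT => le_b; have h1 := lto1M a1 b1.
have [n] := conrad a1 h1; apply: contraLR => _.
have hn_b k : (a * b) ^+ k * b <=o b.
  elim: k => [|k IHk]; first by rewrite mul1g leo_refl.
  by apply: leo_trans le_b; rewrite expgS -(mulgA (a * b) _ b) ltoM2l.
rewrite ltoM2l; apply: leo_trans (hn_b n); apply: ltoW.
by rewrite -[X in X <o _]mulg1 ltoM2l.
Qed.

Definition power_bounded g x := exists n, (g ^- n <=o x) && (x <=o g ^+ n).

Lemma power_bounded_between g u v x : 1 <o g ->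
  power_bounded g u -> power_bounded g v -> u <=o x -> x <=o v ->
  power_bounded g x.
Proof.
move=> g1 [m /andP[mu _]] [n /andP[_ vn]] ux xv; exists (maxn m n).
apply/andP; split.
  by apply: leo_trans ux; apply: leo_trans mu; apply: expVo_le => //; exact: leq_maxl.
apply: (leo_trans xv); apply: (leo_trans vn); apply: expo_le => //; exact: leq_maxr.
Qed.

Lemma power_bounded_shift g x m : 1 <o g -> power_bounded g x ->
  power_bounded g (g ^+ m * x) /\ power_bounded g (g ^- m * x).
Proof.
move=> g1 [n /andP[nx xn]]; split; exists (n + m)%N; apply/andP; split.
- apply: (@leo_trans (g ^- n)); first by apply: expVo_le => //; exact: leq_addr.
  apply: (@leo_trans (g ^+ m * g ^- (n + m))).
    by rewrite expgnDr invgM mulVKg leo_refl.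
  by rewrite ltoM2l; apply: leo_trans nx; apply: expVo_le => //; exact: leq_addr.
- by rewrite addnC expgnDr ltoM2l.
- by rewrite expgnDr invgM ltoM2l.
- apply: (@leo_trans (g ^+ n)); last by apply: expo_le => //; exact: leq_addr.
  apply: (@leo_trans (g ^- m * g ^+ (m + n))).
    rewrite ltoM2l; apply: (leo_trans xn).
    by apply: expo_le => //; exact: leq_addl.
  by rewrite expgnDr mulKg leo_refl.
Qed.

(** This is where the Conradian property enters.  With [b] a positive power of
    [g] that bounds [x] on both sides, the bounds for the inverse of [x] are
    the powers of [b] of exponent 2: a violation of the lower one makes
    [a := x * (b * b)^-1] positive, and [conrad2] gives [b < a * b * b = x],
    against [x <= b]; if the upper one fails, [b * x] is still at least 1, it is
    not 1, and [conrad2] gives [b < b * x * b * b <= b * x * x^-1 = b]. *)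
Lemma power_boundedV g x : 1 <o g -> power_bounded g x -> power_bounded g x^-1.
Proof.
move=> g1 [n /andP[nx xn]]; set b := g ^+ n.+1.
(* The exponent is raised by one because [n] may be 0, and [b] has to be positive. *)
have b1 : 1 <o b by rewrite /b expgSr; apply: (leo_lt_trans (expo_ge1 n g1));
  rewrite -[X in X <o _]mulg1 ltoM2l.
have bx : b^-1 <=o x by apply: leo_trans nx; exact: expVo_le.
have xb : x <=o b by apply: (leo_trans xn); exact: expo_le.
exists (n.+1 + n.+1)%N; rewrite expgnDr -/b; apply/andP; split.
- apply/negP => lt_x; have a1 : 1 <o x * (b * b)^-1.
    by rewrite -(ltoM2l x^-1) mulKg mulg1.
  have := conrad2 a1 b1; rewrite -2!mulgA mulVg mulg1.
  exact/negP.
- apply/negP => lt_bx.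
  have : 1 <=o b * x by rewrite -(ltoM2l b^-1) mulKg mulg1.
  case/leo_eqVlt => [bx1|a1].
    have bV : x^-1 = b by rewrite -[RHS](mulgK x) -bx1 mul1g.
    move: lt_bx; rewrite bV -[X in _ <o X]mulg1 ltoM2l; apply/negP.
    exact: ltoW.
  have := conrad2 a1 b1; apply/negP.
  have : b * x * (b * b) <=o b by rewrite -[X in _ <=o X](mulgK x) ltoM2l ltoW.
  by rewrite mulgA.
Qed.

(** Only left multiplication is monotone, so [x * y] is first placed between
    [x * g ^- n] and [x * g ^+ n]; the inverses of these are obtained from
    [x^-1] by multiplying by powers of [g] on the left. *)
Lemma power_boundedM g x y : 1 <o g ->
  power_bounded g x -> power_bounded g y -> power_bounded g (x * y).
Proof.
move=> g1 xg [n /andP[ny yn]]; have xVg := power_boundedV g1 xg.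
have [sp sn] := power_bounded_shift n g1 xVg.
apply: (power_bounded_between g1 (u := x * g ^- n) (v := x * g ^+ n)).
- by rewrite -(invgK (x * _)) invgM invgK; exact: power_boundedV.
- by rewrite -(invgK (x * _)) invgM; exact: power_boundedV.
- by rewrite ltoM2l.
- by rewrite ltoM2l.
Qed.

Lemma power_bounded1 g : 1 <o g -> power_bounded g 1.
Proof. by exists 0; rewrite !expg0 invg1 leo_refl. Qed.

Lemma power_bounded_id g : 1 <o g -> power_bounded g g.
Proof.
move=> g1; exists 1%N; rewrite expg1 leo_refl andbT; apply: ltoW.
by apply: (lto_trans _ g1); rewrite ltoV1.
Qed.

Lemma power_boundedX g x n : 1 <o g -> power_bounded g x -> power_bounded g (x ^+ n).
Proof.
move=> g1 xg; elim: n => [|n IHn]; first exact: power_bounded1.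
by rewrite expgS; exact: power_boundedM.
Qed.

Lemma power_bounded_trans g f x : 1 <o g ->
  power_bounded g f -> power_bounded f x -> power_bounded g x.
Proof.
move=> g1 fg [n /andP[nx xn]].
have fng := power_boundedX n g1 fg.
exact: power_bounded_between (power_boundedV g1 fng) fng nx xn.
Qed.

Lemma power_bounded_itv g x : 1 <o g -> 1 <=o x -> x <=o g -> power_bounded g x.
Proof.
move=> g1; apply: power_bounded_between => //; [exact: power_bounded1|exact: power_bounded_id].
Qed.

Section Archimedean.
Variable f : G.
Hypotheses (f1 : 1 <o f) (f_cofinal : forall x, power_bounded f x).

(** For positive [x], not being big is being infinitely small with respect
    to [f]. *)
Definition big x := exists n, f <=o x ^+ n.

Lemma big_gt1 x : big x -> 1 <o x.
Proof.
move=> [n fx]; apply: contraT => x1.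
by have /negP := expo_le1 n x1; case; exact: lto_le_trans fx.
Qed.

Lemma big_f : big f. Proof. by exists 1%N; exact: leo_refl. Qed.

(** The elements bounded by powers of a big [x] include [f], and everything is
    bounded by powers of [f]. *)
Lemma big_cofinal x y : big x -> power_bounded x y.
Proof.
move=> xb; have x1 := big_gt1 xb; have [n fx] := xb.
apply: (power_bounded_trans x1 _ (f_cofinal y)).
have px := power_bounded_id x1.
apply: (power_bounded_between x1 (power_bounded1 x1) (power_boundedX n x1 px)) => //.
exact: ltoW.
Qed.

Lemma power_bounded_big x : 1 <o x -> power_bounded x f -> big x.
Proof. by move=> x1 [n /andP[_ fx]]; exists n. Qed.

Lemma big_le x z : x <=o z -> big x -> big z.
Proof.
move=> xz xb; have x1 := big_gt1 xb; have z1 := lto_le_trans x1 xz.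
apply: power_bounded_big => //; apply: power_bounded_trans (big_cofinal f xb) => //.
by apply: power_bounded_itv => //; exact: ltoW.
Qed.

(** Since [x ^ h = h^-1 * (x * h)], the inequality [f <= (x ^ h) ^+ k] means
    [h * f <= x ^+ k * h].  The element [h] is at least [x ^- m] for some [m]
    and [h * f] is at most [x ^+ j] for some [j], so [k = j + m] works. *)
Lemma big_conj x h : big x -> big (x ^ h).
Proof.
move=> xb; have x1 := big_gt1 xb.
have [m /andP[mh _]] := big_cofinal h xb.
have [j /andP[_ hj]] := big_cofinal (h * f) xb.
exists (j + m)%N; rewrite -conjXg conjgE -(ltoM2l h) mulVKg.
apply: (leo_trans hj); rewrite expgnDr -mulgA -[X in _ <o X]mulg1 ltoM2l.
by rewrite -(ltoM2l (x ^- m)) mulKg mulg1.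
Qed.

Lemma bigC u v : big (u * v) -> big (v * u).
Proof. by move=> /(big_conj u); rewrite conjgE mulgA mulKg. Qed.

(** If one factor is at most 1, the other one is big by comparison with [u * v]
    or its conjugate [v * u].  Otherwise both are bounded by powers of the
    larger one, which therefore bound [u * v], hence [f]. *)
Lemma bigM_or u v : big (u * v) -> big u \/ big v.
Proof.
move=> uvb; have [u1|u1] := boolP (1 <o u); last first.
  right; apply: big_le (bigC uvb).
  by rewrite -[X in X <o _]mulg1 ltoM2l.
have [v1|v1] := boolP (1 <o v); last first.
  left; apply: big_le uvb.
  by rewrite -[X in X <o _]mulg1 ltoM2l.
have key w : 1 <o w -> u <=o w -> v <=o w -> big w.
  move=> w1 uw vw; apply: power_bounded_big => //.
  apply: power_bounded_trans (big_cofinal f uvb) => //.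
  by apply: power_boundedM => //; apply: power_bounded_itv => //; exact: ltoW.
have [uv|vu] := boolP (u <o v).
  by right; apply: key; rewrite ?lto_irr// ltoW.
by left; apply: key; rewrite ?lto_irr.
Qed.

Lemma bigM u v : big u -> big v -> big (u * v).
Proof.
move=> ub vb; apply: big_le ub; rewrite -[X in _ <o X]mulg1 ltoM2l ltoW//.
exact: big_gt1.
Qed.

Lemma bigVF u : big u -> ~ big u^-1.
Proof.
by move=> /big_gt1 u1 /big_gt1; rewrite lto1V; apply/negP/ltoW.
Qed.

(** The order induced on the quotient by the elements that are neither big nor
    inverse to a big one: the induced non-strict order is the negation of
    the reversed relation. *)
Definition far_below x y := big (x^-1 * y).
Local Notation "x <<o y" := (far_below x y) (at level 70).

Lemma far_belowM2l z x y : (z * x <<o z * y) <-> (x <<o y).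
Proof. by rewrite /far_below invgM -mulgA mulKg. Qed.

Lemma far_belowM x y x' y' : x <<o y -> x' <<o y' -> x * x' <<o y * y'.
Proof.
move=> xy xy'; rewrite /far_below invgM -mulgA; apply: bigC.
by rewrite -!mulgA mulgA; apply: bigM => //; exact: bigC.
Qed.

Lemma Nfar_belowM x y x' y' :
  ~ x <<o y -> ~ x' <<o y' -> ~ x * x' <<o y * y'.
Proof.
move=> xy xy'; rewrite /far_below invgM -mulgA => /bigC.
by rewrite -!mulgA mulgA => /bigM_or[//|/bigC].
Qed.

Lemma Nfar_below_trans y x z : ~ x <<o y -> ~ y <<o z -> ~ x <<o z.
Proof.
move=> xy yz xz; have : big ((x^-1 * y) * (y^-1 * z)) by rewrite -mulgA mulVKg.
by case/bigM_or.
Qed.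

Lemma far_below_asym x y : x <<o y -> ~ y <<o x.
Proof. by move=> /bigVF; rewrite invgM invgK. Qed.

(** The element [t] is the greatest integer power of [d] that is not far above
    [a]; all that matters later about its being a power of [d] is that it
    commutes with whatever commutes with [d]. *)
Lemma power_floor d a : big d ->
  exists t, [/\ forall z, commute d z -> commute t z,
                ~ a <<o t & a <<o t * d].
Proof.
move=> db; have d1 := big_gt1 db; have [n /andP[na an]] := big_cofinal a db.
pose P i := `[< a <<o d ^- n * d ^+ i >].
have exP : exists i, P i.
  exists (n + n.+1)%N; apply/asboolP; rewrite /far_below expgnDr mulKg expgSr mulgA.
  apply: bigC; apply: big_le db; rewrite -[X in _ <o X]mulg1 ltoM2l.
  by rewrite -(ltoM2l a) mulVKg mulg1.
have [[|i] /asboolP Pi min_i] := ex_minnP exP.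
  move: Pi; rewrite /far_below mulg1 => /big_gt1.
  by rewrite -(ltoM2l a) mulVKg mulg1 (negbTE na).
exists (d ^- n * d ^+ i); split.
- move=> z /commute_sym dz; apply: commute_sym; apply: commuteM.
    by apply: commuteV; exact: commuteX.
  exact: commuteX.
- by move=> /asboolP Pi'; have := min_i _ Pi'; rewrite ltnn.
- by rewrite -mulgA -expgSr.
Qed.

(** The argument of Hoelder.  Suppose that [c], the quotient of [a * b] by
    [b * a], is big.  If some big [u] lies far below [c], the smaller of [u]
    and [u^-1 * c] is a big [d] whose square is not far above [c].  Choosing
    powers [t], [t'] of [d] with [t <= a << t * d] and [t' <= b << t' * d], one
    gets [a * b << t * t' * (d * d)] and [t * t' <= b * a], so that [c << d * d],
    a contradiction.  If no big element lies far below [c], the same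
    approximation with [d = c] is exact, which makes [a] and [b] powers of [c]
    up to elements that are not big, and [c] would not be big. *)
Lemma Nbig_commg a b : ~ big [~ a, b].
Proof.
have -> : [~ a, b] = (b * a)^-1 * (a * b) by rewrite commgEl conjgE invgM !mulgA.
set c := _ * _ => cb.
have cE : b * a * c = a * b by rewrite /c mulVKg.
have [[u [ub uc]]|minc] := pselect (exists u, big u /\ u <<o c).
- have [d [db dc]] : exists d, big d /\ ~ c <<o d * d.
    have cuv : c = u * (u^-1 * c) by rewrite mulVKg.
    have [vu|uv] := pselect (u^-1 * c <<o u).
      set v := u^-1 * c in cuv vu *; exists v; split=> //.
      rewrite /far_below {1}cuv invgM -mulgA (mulgA u^-1) => /bigC.
      rewrite mulgK; exact: far_below_asym.
    by exists u; split=> //; rewrite {1}cuv => /far_belowM2l.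
  have [t [tC ta at_]] := power_floor a db.
  have [t' [tC' tb bt]] := power_floor b db.
  (* Now [a * b = b * a * c] is both far below and not far below [t' * t * (d * d)]. *)
  have := far_belowM at_ bt; rewrite -cE.
  have -> : t * d * (t' * d) = t' * t * (d * d).
    have dt' : commute t' d by apply: tC'.
    have tt' : commute t t' by apply: tC; exact: commute_sym.
    by rewrite -!mulgA (mulgA d) -dt' -mulgA (mulgA t) tt' -!mulgA.
  apply: Nfar_belowM => //; exact: Nfar_belowM.
- have [t [tC ta at_]] := power_floor a cb.
  have [t' [tC' tb bt]] := power_floor b cb.
  (* By minimality of [c], there is nothing big strictly between [1] and [c]. *)
  have min x y : x <<o y * c -> ~ y <<o x.
    move=> xy yx; apply: minc; exists (y^-1 * x); split => //.
    by rewrite -(far_belowM2l y) mulVKg.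
  have tt' : commute t t' by apply: tC; apply: commute_sym; exact: tC'.
  apply: (@Nfar_below_trans (t' * t) (b * a) (a * b)) => //.
    exact: Nfar_belowM.
  by rewrite -tt'; apply: Nfar_belowM; exact: min.
Qed.

End Archimedean.
End LeftOrder.

(** * Homomorphisms from finitely generated groups to the integers *)

Section IntegerPowers.
Variable G : groupType.
Implicit Types a x y : G.

Definition zpow a (k : int) : G :=
  match k with Posz n => a ^+ n | Negz n => a ^- n.+1 end.

Lemma zpowB a (i j : nat) : zpow a (i%:Z - j%:Z)%R = a ^+ i / a ^+ j.
Proof.
case: (leqP j i) => [ji|ij]; first by rewrite -expgnFr// subzn.
rewrite -(invgK (_ / _)) invgF -expgnFr; last exact: ltnW.
have -> : (i%:Z - j%:Z)%R = Negz (j - i).-1 by lia.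
by rewrite /= prednK // subn_gt0.
Qed.

Lemma zpowD a (k l : int) : zpow a (k + l)%R = zpow a k * zpow a l.
Proof.
have diff (m : int) : exists i j : nat, m = (i%:Z - j%:Z)%R.
  by case: m => n; [exists n, 0; lia | exists 0, n.+1; lia].
have [i [j ->]] := diff k; have [i' [j' ->]] := diff l.
have -> : (i%:Z - j%:Z + (i'%:Z - j'%:Z) = (i + i')%:Z - (j' + j)%:Z)%R by lia.
have cij : commute (a ^+ i') (a ^- j) by apply: commuteV; exact: commuteX2.
by rewrite !zpowB !expgnDr invgM -!mulgA (mulgA (a ^+ i')) cij -!mulgA.
Qed.

Lemma zpowN a (k : int) : zpow a (- k)%R = (zpow a k)^-1.
Proof. by apply/esym/mulg1_eq; rewrite -zpowD subrr. Qed.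

End IntegerPowers.

Definition subgroup_set (G : groupType) (A : set G) :=
  [/\ A 1, forall x y, A x -> A y -> A (x * y) & forall x, A x -> A x^-1].

(** The quotient [G / N] is abelian because [N] contains the commutators, and
    torsion-free because [N] is isolated; all statements about it are phrased
    in terms of subgroups of [G] that contain [N]. *)
Section TorsionFreeAbelianQuotient.
Variables (G : groupType) (N : set G).
Implicit Types (a x y : G) (B : set G) (psi : G -> int).
Hypothesis N_group : subgroup_set N.
Hypothesis N_commg : forall x y, N [~ x, y].
Hypothesis N_isolated : forall x n, N (x ^+ n.+1) -> N x.

Let NM x y : N x -> N y -> N (x * y). Proof. by case: N_group => _ + _; exact. Qed.

Let NJ x y : N x -> N (x ^ y).
Proof.
by move=> Nx; rewrite -(mulVKg x (x ^ y)) -commgEl; exact: NM.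
Qed.

Lemma expgM_mod x y n : exists2 c, N c & (x * y) ^+ n = x ^+ n * y ^+ n * c.
Proof.
elim: n => [|n [c Nc IHn]]; first by exists 1; [case: N_group|rewrite !mulg1].
exists (([~ y ^+ n, x] * c ^ x) ^ y); first by apply: NJ; apply: NM => //; exact: NJ.
by rewrite expgSr IHn !expgSr commgEl !conjgE !gnorm.
Qed.

Definition over_N B := subgroup_set B /\ N `<=` B.

Lemma memC_mod B x y : over_N B -> B (x * y) -> B (y * x).
Proof.
move=> [[_ BM _] NB] Bxy; rewrite commgC; apply: (BM) => //; exact/NB/N_commg.
Qed.

(** A nonzero homomorphism to the integers from the quotient [B / N]. *)
Definition has_character B := exists psi,
  [/\ forall x y, B x -> B y -> psi (x * y) = (psi x + psi y)%R,
      forall x, N x -> psi x = 0%R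
    & exists2 x, B x & psi x <> 0%R].

Lemma character_exp B psi x n : over_N B ->
    (forall x y, B x -> B y -> psi (x * y) = (psi x + psi y)%R) ->
  B x -> psi (x ^+ n) = (psi x *+ n)%R /\ B (x ^+ n).
Proof.
move=> [[B1 BM _] _] psiM Bx; elim: n => [|n [IHn Bn]].
  split=> //; have := psiM _ _ B1 B1; rewrite mulg1 mulr0n => /eqP.
  by rewrite -subr_eq0 opprD addNKr oppr_eq0 => /eqP.
by rewrite expgS psiM// IHn mulrS; split=> //; exact: BM.
Qed.

(** When some positive power of [a] lies in [B], the elements whose power of the
    same exponent lies in [B] form a subgroup containing [a], to which a
    homomorphism extends up to a nonzero factor by composing it with that power
    map; the power map is a homomorphism modulo [N]. *)
Lemma adjoin_root B a n : over_N B -> B (a ^+ n.+1) -> B `<=` N \/ has_character B ->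
  exists B', [/\ over_N B', B `<=` B', B' a & B' `<=` N \/ has_character B'].
Proof.
move=> bB Ban [BN|[psi [psiM psiN [x0 Bx0 psix0]]]].
  by exists B; split=> //; [apply/bB.2/N_isolated/BN/Ban|left].
have [[B1 BM BV] NB] := bB.
have BX x : B x -> B (x ^+ n.+1) by case/(character_exp n.+1 bB psiM).
exists [set x | B (x ^+ n.+1)]; split=> //=.
- split; last by move=> x /NB/BX.
  split=> /=; first by rewrite expg1n.
  + move=> x y Bx By; have [c Nc ->] := expgM_mod x y n.+1.
    by apply: (BM); [exact: BM|exact: NB].
  + by move=> x Bx; rewrite expVgn; exact: BV.
- right; exists (fun x => psi (x ^+ n.+1)); split=> [x y Bx By|x Nx|].
  + have [c Nc ->] := expgM_mod x y n.+1.
    by rewrite !psiM ?(psiN c) ?addr0//; [exact: BM|exact: NB].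
  + have [-> _] := character_exp n.+1 bB psiM (NB x Nx).
    by rewrite psiN// mul0rn.
  + exists x0; first exact: BX.
    have [-> _] := character_exp n.+1 bB psiM Bx0.
    by apply/eqP; rewrite mulrn_eq0 //=; exact/eqP.
Qed.

(** When no positive power of [a] lies in [B], the group generated by [B] and
    [a] is modulo [N] the direct product of [B] and an infinite cyclic group, and
    the projection on the latter is the required homomorphism. *)
Lemma adjoin_free B a : over_N B -> (forall n, ~ B (a ^+ n.+1)) ->
  exists B', [/\ over_N B', B `<=` B', B' a & has_character B'].
Proof.
move=> bB Ba; have [[B1 BM BV] NB] := bB.
have zpowB0 k : B (zpow a k) -> k = 0%R.
  by case: k => [[//|n] /Ba//|n /BV]; rewrite /= invgK => /Ba.
pose B' := [set x | exists k, B (x / zpow a k)].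
have uniqk x k l : B (x / zpow a k) -> B (x / zpow a l) -> k = l.
  move=> Bk Bl; apply/eqP; rewrite -subr_eq0; apply/eqP/zpowB0.
  have := BM _ _ (BV _ Bk) Bl; rewrite invgF -mulgA mulKg -zpowN -zpowD.
  by [].
have addk x y k l : B (x / zpow a k) -> B (y / zpow a l) ->
    B (x * y / zpow a (k + l)%R).
  move=> Bx By; rewrite zpowD invgM mulgA; apply: (memC_mod bB).
  by rewrite -(mulgA x) (mulgA _ x); apply: (BM) => //; exact: (memC_mod bB).
pose psi x : int := xget 0%R [set k | B (x / zpow a k)].
have psiP x k : B (x / zpow a k) -> psi x = k.
  by move=> Bk; rewrite /psi; case: xgetP => [l _ Bl|/(_ k)//]; exact: (uniqk x).
have BB' : B `<=` B' by move=> x Bx; exists 0%R; rewrite invg1 mulg1.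
have a1 : B (a / zpow a 1) by rewrite mulgV.
exists B'; split=> //.
- split; last exact: subset_trans BB'.
  split; first exact: BB'.
  + by move=> x y [k Bk] [l Bl]; exists (k + l)%R; exact: addk.
  + move=> x [k Bk]; exists (- k)%R; rewrite zpowN invgK.
    by apply: (memC_mod bB); rewrite -invgF; exact: BV.
- by exists 1%R.
- exists psi; split.
  + by move=> x y [k Bk] [l Bl]; rewrite (psiP _ _ Bk) (psiP _ _ Bl); apply/psiP/addk.
  + by move=> x Nx; apply: psiP; rewrite invg1 mulg1; exact: NB.
  + by exists a; [exists 1%R|rewrite (psiP _ _ a1)].
Qed.

(** Starting from [N], the generators are adjoined one at a time; the invariant
    is that the subgroup obtained so far has a nonzero homomorphism to the
    integers as soon as it is larger than [N]. *)
Lemma torsion_free_character (s : seq G) x :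
  (forall B, over_N B -> (forall a, a \in s -> B a) -> B = setT) ->
  ~ N x -> has_character setT.
Proof.
move=> gen Nx.
suff [B [bB sB [BN|charB]]] : exists B, [/\ over_N B, forall a, a \in s -> B a
    & B `<=` N \/ has_character B].
- by case: Nx; apply: BN; rewrite (gen B).
- by rewrite -(gen B).
elim: (s) => [|a {s gen}s [B [bB sB charB]]].
  by exists N; split=> [||]; [split|by []|left].
have [B' [bB' BB' B'a charB']] :
    exists B', [/\ over_N B', B `<=` B', B' a & B' `<=` N \/ has_character B'].
  have [[n Ban]|Ba] := pselect (exists n, B (a ^+ n.+1)).
    exact: adjoin_root Ban charB.
  have [|B' [? ? ? ?]] := @adjoin_free B a bB; first by move=> n Ban; apply: Ba; exists n.
  by exists B'; split=> //; right.
exists B'; split=> // b; rewrite inE => /predU1P[->//|/sB]; exact: BB'.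
Qed.

End TorsionFreeAbelianQuotient.

(** The image is generated by its smallest positive element, by Euclidean
    division. *)
Lemma surjective_character (G : groupType) (psi : G -> int) :
    (forall x y, psi (x * y) = (psi x + psi y)%R) -> (exists x, psi x <> 0%R) ->
  exists2 phi : G -> int, forall x y, phi (x * y) = (phi x + phi y)%R
    & forall n, exists x, phi x = n.
Proof.
move=> psiM [x0 psix0].
have psi1 : psi 1 = 0%R by have := psiM 1 1; rewrite mulg1; lia.
have psiV x : psi x^-1 = (- psi x)%R by have := psiM x x^-1; rewrite mulgV; lia.
have psiX x n : psi (x ^+ n) = (psi x * n%:Z)%R.
  by elim: n => [|n IHn]; rewrite ?mulr0// expgS psiM IHn; lia.
have psiZ x k : psi (zpow x k) = (psi x * k)%R.
  by case: k => n; rewrite /= ?psiV psiX// NegzE mulrN.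
pose P n := `[< exists x, psi x = Posz n.+1 >].
have exP : exists n, P n.
  exists `|psi x0|.-1%N; apply/asboolP.
  have [neg|pos] := leP (psi x0) 0%R; last by exists x0; lia.
  by exists x0^-1; rewrite psiV; lia.
(* The smallest positive value of [psi] is [n.+1], taken at [d]. *)
have [n /asboolP[d psid] min_n] := ex_minnP exP.
have dvd x : psi x = ((psi x %/ Posz n.+1)%Z * Posz n.+1)%R.
  have /(_ isT) r_ge0 := @modz_ge0 (psi x) (Posz n.+1).
  have r_lt := @ltz_pmod (psi x) (Posz n.+1) isT.
  have psir : psi (x * zpow d (- (psi x %/ Posz n.+1)%Z)%R) = (psi x %% Posz n.+1)%Z.
    by rewrite psiM psiZ psid mulrN mulrC; apply/eqP;
      rewrite subr_eq addrC -divz_eq.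
  suff r0 : (psi x %% Posz n.+1)%Z = 0%R by rewrite {1}(divz_eq (psi x) (Posz n.+1)) r0 addr0.
  apply: contrapT => r_neq0.
  have : P `|(psi x %% Posz n.+1)%Z|.-1%N.
    by apply/asboolP; exists (x * zpow d (- (psi x %/ Posz n.+1)%Z)%R); lia.
  by move/min_n; lia.
exists (fun x => (psi x %/ Posz n.+1)%Z) => [x y|k].
  by rewrite psiM (dvd x) (dvd y) -mulrDl !mulzK.
by exists (zpow d k); rewrite psiZ psid mulrC mulzK.
Qed.

(** * Conradian orders on finitely generated groups *)

Section ConradianCharacter.
Variables (G : groupType) (lt : rel G) (s : seq G).
Hypotheses (ltG : left_invariant_order lt) (conrad : conradian lt).
Hypothesis s_gen : forall K : set G,
  subgroup_set K -> (forall a, a \in s -> K a) -> K = setT.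

(** Take for [f] the largest of the generators and their inverses: the subgroup
    of the elements bounded by powers of [f] contains the generators.  A
    nontrivial [x0] makes up for the case where no generator is given. *)
Lemma cofinal_element (x0 : G) : x0 != 1 ->
  exists2 f : G, lt 1 f & forall x, power_bounded lt f x.
Proof.
move=> x0n1.
have abs x : exists2 y : G, ~~ lt y 1 & x = y \/ x = y^-1.
  have [x1|] := boolP (lt x 1); last by exists x => //; left.
  by exists x^-1; [apply: ltoW; rewrite ?lto1V|right; rewrite invgK].
suff [f f1 fs] : exists2 f : G, lt 1 f & forall a, a \in s -> power_bounded lt f a.
  exists f => // x; suff -> : power_bounded lt f = setT by [].
  apply: s_gen => //; split; first exact: power_bounded1.
    by move=> y z; exact: power_boundedM.
  by move=> y; exact: power_boundedV.
elim: (s) => [|a s' [f f1 fs]].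
  have [y /(leo_eqVlt ltG)[<-|y1 _]] := abs x0; last by exists y.
  by rewrite invg1 => -[] x01; rewrite x01 eqxx in x0n1.
have [b b1 ab] := abs a.
have [h [h1 fh bh]] : exists h : G, [/\ lt 1 h, ~~ lt h f & ~~ lt h b].
  have [fb|bf] := boolP (lt f b); last by exists f; split; rewrite ?lto_irr.
  by exists b; split; [exact: lto_trans fb|exact: ltoW|rewrite lto_irr].
exists h => // c; rewrite inE => /predU1P[->|/fs fc].
  have hb : power_bounded lt h b by exact: power_bounded_itv.
  by case: ab => ->//; exact: power_boundedV.
apply: power_bounded_trans fc => //.
by apply: power_bounded_itv => //; exact: ltoW.
Qed.

(** The subgroup of the elements that are infinitely small with respect to a
    cofinal element is the largest proper convex subgroup; its quotient is
    torsion-free and abelian. *)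
Theorem conradian_character (x0 : G) : x0 != 1 ->
  exists2 phi : G -> int, forall x y, phi (x * y) = (phi x + phi y)%R
    & forall n, exists x, phi x = n.
Proof.
move=> /cofinal_element[f f1 fcof].
pose N : set G := [set x | ~ big lt f x /\ ~ big lt f x^-1].
have big1 : ~ big lt f 1 by move=> /(big_gt1 ltG f1); rewrite lto_irr.
have N_group : subgroup_set N.
  split; first by rewrite /N /= invg1.
  - move=> x y [x1 x2] [y1 y2]; split; last rewrite invgM.
      by case/(bigM_or ltG conrad f1 fcof).
    by case/(bigM_or ltG conrad f1 fcof).
  - by move=> x [x1 x2]; split; rewrite ?invgK.
have N_commg x y : N [~ x, y].
  by split; rewrite ?invgR; exact: Nbig_commg.
have bigX x n : big lt f x -> big lt f (x ^+ n.+1).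
  by elim: n => [|n IHn] bx //; rewrite expgS; apply: bigM => //; exact: IHn.
have N_isolated x n : N (x ^+ n.+1) -> N x.
  by move=> [xn xVn]; split=> [/(bigX _ n)//|/(bigX _ n)]; rewrite expVgn.
have Nf : ~ N f by case=> + _; apply; exact: big_f.
have [|psi [psiM _ [x _ psix]]] :=
    torsion_free_character N_group N_commg N_isolated (s := s) _ Nf.
  by move=> B [Bgrp _]; exact: s_gen.
by apply: (@surjective_character G psi); [move=> *; exact: psiM|exists x].
Qed.

End ConradianCharacter.

(** * Poincare recurrence *)

(** Let [W] be the set of the points of [A] that never return to [A].  Its
    preimages under the iterates of [f] are pairwise disjoint and have the same
    measure, and in a space of measure 1 this forces [W] to be null. *)
Lemma poincare_recurrence (d : measure_display) (T : measurableType d)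
    (R : realType) (mu : probability T R) (f : T -> T) (A : set T) :
    measurable_fun setT f ->
    (forall B, measurable B -> mu (f @^-1` B) = mu B) -> measurable A ->
  mu.-negligible [set x | A x /\ forall n, ~ A (iter n.+1 f x)].
Proof.
move=> mf invf mA; set W := [set x | _].
have preS n B : iter n.+1 f @^-1` B = f @^-1` (iter n f @^-1` B).
  by apply/funext => x; rewrite /preimage/= -iterS iterSr.
have mfX n B : measurable B -> measurable (iter n f @^-1` B).
  move=> mB; elim: n => [//|n IHn].
  by rewrite preS -[X in measurable X]setTI; apply: mf.
have invfX n B : measurable B -> mu (iter n f @^-1` B) = mu B.
  by move=> mB; elim: n => [//|n IHn]; rewrite preS invf ?IHn//; exact: mfX.
have mW : measurable W.
  have -> : W = A `&` ~` \bigcup_n (iter n.+1 f @^-1` A).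
    apply/seteqP; split=> x /= [Ax nA]; split=> //.
      by move=> [n _ /(nA n)].
    by move=> n An; apply: nA; exists n.
  apply: measurableI => //; apply: measurableC; apply: bigcupT_measurable => n.
  exact: mfX.
have trivW : trivIset setT (fun n => iter n f @^-1` W).
  apply/trivIsetP => i j _ _; wlog ij : i j / (i < j)%N => [hw|_].
    by rewrite neq_ltn => /orP[ij|ji]; [|rewrite setIC]; apply: hw => //; rewrite neq_ltn ?ij ?ji ?orbT.
  apply/seteqP; split=> // x [[_ /(_ (j - i).-1) ret] [Aj _]]; apply: ret.
  by rewrite -iterD prednK ?subn_gt0// subnK// ltnW.
apply/negligibleP => //.
have le1 n : (\sum_(i < n) mu W <= 1)%E.
  have mbig : measurable (\big[setU/set0]_(i < n) (iter i f @^-1` W)).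
    by apply: bigsetU_measurable => i _; exact: mfX.
  apply: le_trans (probability_le1 mu mbig).
  rewrite (@measure_semi_additive_ord_I _ _ _ mu (fun i => iter i f @^-1` W))//.
  - by apply: lee_sum => i _; rewrite -{1}(invfX i W mW).
  - by move=> k _; exact: mfX.
  - exact: sub_trivIset trivW.
suff : mu W = 0%E by [].
have : (0 <= mu W)%E by exact: measure_ge0.
have : mu W \is a fin_num by exact: fin_num_measure.
case: (mu W) le1 => [r|//|//] le1 _; rewrite lee_fin => r0.
congr (_%:E); apply/eqP; rewrite eq_le r0 andbT leNgt; apply/negP => rpos.
have := le1 (Num.truncn r^-1).+1.
rewrite sumEFin sumr_const card_ord lee_fin leNgt -mulr_natr => /negP; apply.
by rewrite -ltr_pdivrMl// mulr1 truncnS_gt.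
Qed.

(** * The space of left-invariant orders *)

Section SpaceOfLeftOrders.
Variable G : groupType.
Local Notation cube := (prod_topology (fun _ : (G * G)%type => bool)).

Definition left_orders : set cube :=
  [set r | left_invariant_order (fun x y => r (x, y))].

Lemma nbhs_cylinder (I : eqType) (r : prod_topology (fun _ : I => bool)) (i : I) :
  \forall q \near r, q i = r i.
Proof.
exact: (@proj_continuous I (fun=> bool) i r [set r i] (discrete_set1 (r i))).
Qed.

(** Each instance of an axiom of left-invariant orders involves at most three
    values of the relation, and a relation in the closure agrees with some
    left-invariant order on any three pairs. *)
Lemma left_orders_closed : closed left_orders.
Proof.
move=> r clr.
have agree i j k : exists2 q : cube, left_orders q & [/\ q i = r i, q j = r j & q k = r k].
  have [q [oq [? [? ?]]]] := clr _ (filterI (nbhs_cylinder r i)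
    (filterI (nbhs_cylinder r j) (nbhs_cylinder r k))).
  by exists q.
split.
- move=> x; have [q [irr _ _ _] [<- _ _]] := agree (x, x) (x, x) (x, x).
  exact: irr.
- move=> y x z; have [q [_ tr _ _] [<- <- <-]] := agree (x, y) (y, z) (x, z).
  exact: tr.
- move=> x y; have [q [_ _ tot _] [<- <- _]] := agree (x, y) (y, x) (x, x).
  exact: tot.
- move=> g x y; have [q [_ _ _ inv] [<- <- _]] := agree (x, y) (g * x, g * y) (x, x).
  exact: inv.
Qed.

Lemma left_orders_compact : compact left_orders.
Proof.
apply: (subclosed_compact left_orders_closed) (@subsetT _ _).
have := @tychonoff (G * G)%type (fun=> bool) _ (fun=> bool_compact).
by congr (compact _); rewrite eqEsubset.
Qed.

Lemma left_invariant_order_Mr (r : cube) (g : G) :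
  left_orders r -> left_orders (fun p => r (p.1 * g, p.2 * g)).
Proof.
move=> [irr tr tot inv]; split => /=.
- by move=> x; exact: irr.
- by move=> y x z; exact: tr.
- by move=> x y xy; apply: tot; rewrite (inj_eq (@mulIg _ g)).
- by move=> h x y; rewrite -!mulgA; exact: inv.
Qed.

Definition translate_order (g : G) (r : left_orders) : left_orders :=
  exist (fun q => q \in left_orders) _
    (mem_set (left_invariant_order_Mr g (set_valP r))).

Lemma eval_order_continuous p : continuous (fun r : left_orders => set_val r p).
Proof.
move=> r; apply: (@continuous_comp _ _ _ (@set_val cube left_orders)
  (@proj _ (fun=> bool) p)); first exact: initial_continuous.
exact: proj_continuous.
Qed.

Lemma translate_order_continuous g : continuous (translate_order g).
Proof.
apply: continuous_comp_initial => r.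
have FF : Filter ((set_val \o translate_order g) @ r).
  by apply: fmap_filter; exact: nbhs_filter.
apply/(@pointwise_cvgP (discrete_topology (G * G)%type) bool
  ((set_val \o translate_order g) @ r)) => p.
exact: (@eval_order_continuous (p.1 * g, p.2 * g)).
Qed.

End SpaceOfLeftOrders.

Lemma set_type_compact (X : topologicalType) (A : set X) :
  compact A -> compact [set: A].
Proof.
move=> cA F PF _.
have [|p [Ap clp]] := cA (set_val @ F) _.
  by apply: (@filterS _ F _ setT) filterT => x _; exact: set_valP.
exists (exist _ p (mem_set Ap)); split=> // B U FB [V [[W oW WV] /= Vp VU]].
rewrite -WV in Vp VU.
have F_B : F (set_val @^-1` (set_val @` B)).
  by apply: filterS FB => x Bx; exists x.
have [_ [[x Bx <-] Wx]] := clp _ _ F_B (open_nbhs_nbhs (conj oW Vp)).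
by exists x; split=> //; exact: VU.
Qed.

Lemma set_type_hausdorff (X : topologicalType) (A : set X) :
  hausdorff_space X -> hausdorff_space A.
Proof.
move=> hX p q clpq; apply/val_inj/hX => U V Up Vq.
have [r [Ur Vr]] := clpq _ _ (@initial_continuous _ _ (@set_val X A) p U Up)
  (@initial_continuous _ _ (@set_val X A) q V Vq).
by exists (set_val r).
Qed.

(** * A recurrent order on an amenable group *)

(** Right translation by [b ^+ n] turns the inequality [1 < a] into
    [b ^+ n < a * b ^+ n], so recurrence of the set of orders in which [1 < a]
    under right translation by [b] is the required property.  It holds almost
    everywhere for each pair of terms of [e], hence almost everywhere for all
    of these countably many pairs at once. *)
Lemma amenable_recurrent_order (R : realType) (G : groupType) (e : nat -> G) :
    amenable R G -> left_orderable G ->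
  exists2 lt : rel G, left_invariant_order lt
    & forall i j, lt 1 (e i) -> exists n, lt (e j ^+ n.+1) (e i * e j ^+ n.+1).
Proof.
move=> amG [lt0 lt0G].
have r0 : @left_orders G by exists (fun p => lt0 p.1 p.2); apply: mem_set.
pose X : ptopologicalType := HB.pack (set_type (@left_orders G))
  (isPointed.Build (set_type (@left_orders G)) r0).
pose act : G -> X -> X := @translate_order G.
have act1 x : act 1 x = x.
  by apply/val_inj/funext => -[u v] /=; rewrite !mulg1.
have actM g h x : act (g * h) x = act g (act h x).
  by apply/val_inj/funext => -[u v] /=; rewrite !mulgA.
have act_cont : continuous_action act.
  split=> // -[g x] U Ux.
  exists ([set g], act g @^-1` U); last by move=> [h y] /= [-> Uy].
  split; first exact: (@discrete_set1 (discrete_topology G)).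
  exact: translate_order_continuous.
have cX : compact [set: X] by apply: set_type_compact; exact: left_orders_compact.
have hX : hausdorff_space X.
  apply: set_type_hausdorff; apply: hausdorff_product => _.
  exact: discrete_hausdorff.
have [mu mu_inv] := amG X act cX hX act_cont.
pose T := g_sigma_algebraType (@open X).
have mact g : measurable_fun [set: T] (act g : T -> T).
  apply: (@measurability _ _ T T setT (act g) (@open X)) => // _ [U oU <-].
  rewrite setTI; apply: sub_sigma_algebra.
  by move/continuousP: (@translate_order_continuous G g); exact.
pose pos i : set T := [set r : X | set_val r (1, e i)].
have mpos i : measurable (pos i).
  apply: sub_sigma_algebra.
  apply: (open_comp _ (discrete_open [set true])) => r _.
  exact: eval_order_continuous.
have iter_act g n (r : X) u v :
    set_val (iter n (act g) r) (u, v) = set_val r (u * g ^+ n, v * g ^+ n).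
  elim: n u v => [|n IHn] u v; first by rewrite !mulg1.
  by rewrite iterS [LHS]IHn /= !expgS !mulgA.
pose bad k := let: (i, j) := odflt (0, 0) (unpickle k) in
  [set r : T | pos i r /\ forall n, ~ pos i (iter n.+1 (act (e j) : T -> T) r)].
have [N [mN muN0 badN]] : mu.-negligible (\bigcup_k bad k).
  apply: negligible_bigcup => k; rewrite /bad; case: (odflt _ _) => i j.
  by apply: poincare_recurrence => // B mB; exact: mu_inv.
(* The bad orders lie in a null set, which cannot be the whole space. *)
have [r rN] : exists r, ~ N r.
  apply: contrapT => /forallNP allN.
  have NT : N = setT by apply/seteqP; split=> // r _; exact: contrapT (allN r).
  by have := probability_setT mu; rewrite -NT muN0 => /eqP; rewrite eqe eq_sym oner_eq0.
exists (fun x y => set_val (r : X) (x, y)); first exact: (set_valP (r : X)).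
move=> i j pos_i; apply: contrapT => /forallNP norec; apply/rN/badN.
exists (pickle (i, j)) => //; rewrite /bad pickleK /=; split=> // n.
by rewrite /pos /= -iterS iter_act mul1g; exact: norec.
Qed.

(** * Finitely generated subgroups *)

Section SubgroupType.
Variables (G : groupType) (H : {pred G}).

(** The closure proof is part of the type so that the group structure can be
    inferred from it. *)
Definition subgroup_type (H_group : group_closed H) := {x : G | x \in H}.

Variable H_group : group_closed H.
HB.instance Definition _ := SubChoice.on (subgroup_type H_group).
HB.instance Definition _ :=
  SubChoice_isSubGroup.Build G H (subgroup_type H_group) H_group.
End SubgroupType.

Lemma generated_by_countable (G : groupType) (s : seq G) (H : {pred G}) :
  generated_by s H -> exists e : nat -> G, forall h, h \in H -> exists i, e i = h.
Proof.
move=> [_ gen].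
pose letter (p : nat * bool) : G := let x := nth 1 s p.1 in if p.2 then x^-1 else x.
pose word w := foldr (fun p x => letter p * x) 1 w.
have word_cat v w : word (v ++ w) = word v * word w.
  by elim: v => [|p v IHv] /=; rewrite ?mul1g// IHv mulgA.
have wordV w : exists v, word v = (word w)^-1.
  elim: w => [|p w [v IHw]]; first by exists [::]; rewrite /= invg1.
  exists (v ++ [:: (p.1, ~~ p.2)]); rewrite word_cat IHw /= mulg1 invgM.
  by congr (_ * _); rewrite /letter /=; case: p.2; rewrite ?invgK.
pose K : {pred G} := [pred x | `[< exists w, word w = x >]].
exists (fun k => word (odflt [::] (unpickle k))) => h hH.
have /asboolP[w <-] : h \in K.
  apply: gen hH.
    split; first by apply/asboolP; exists [::].
    move=> _ _ /asboolP[v <-] /asboolP[w <-]; apply/asboolP.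
    by have [w' <-] := wordV w; exists (v ++ w'); rewrite word_cat.
  move=> x xs; apply/asboolP; exists [:: (index x s, false)].
  by rewrite /= /letter /= mulg1 nth_index.
by exists (pickle w); rewrite pickleK.
Qed.

Theorem theorem2 (R : realType) (G : groupType) :
  amenable R G -> left_orderable G -> locally_indicable G.
Proof.
move=> amG loG H H_group [s genH] [h hH h1].
have [e eH] := generated_by_countable genH.
have [lt ltG rec] := amenable_recurrent_order e amG loG.
have [sH gen] := genH.
pose S : groupType := subgroup_type H_group.
pose ltS : rel S := fun x y => lt (val x) (val y).
have ltSG : left_invariant_order ltS.
  have [irr tr tot inv] := ltG; rewrite /ltS; split=> [x|y x z|x y xy|g x y].
  - exact: irr.
  - exact: tr.
  - by apply: tot; rewrite (inj_eq val_inj).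
  - by rewrite !gmulfM; exact: inv.
have conrad : conradian ltS.
  move=> a b; rewrite /ltS gmulf1 => a1 b1.
  have [i ei] := eH _ (valP a); have [j ej] := eH _ (valP b).
  (* Recurrence gives [b ^+ n.+1 < a * b ^+ n.+1], and [b <= b ^+ n.+1]. *)
  have [|n] := rec i j; first by rewrite ei.
  rewrite ei ej => abn; exists n.+1; rewrite gmulfM gmulfXn.
  exact: leo_lt_trans (@expo_le _ _ ltG _ 1 n.+1 b1 _) abn.
pose s' : seq S := pmap insub s.
have s'_gen (K : set S) : subgroup_set K -> (forall a, a \in s' -> K a) -> K = setT.
  move=> [K1 KM KV] sK.
  pose K' : {pred G} := [pred x | `[< exists2 y : S, K y & val y = x >]].
  have HK' : {subset H <= K'}.
    apply: gen.
      split; first by apply/asboolP; exists 1; rewrite ?gmulf1.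
      move=> _ _ /asboolP[x Kx <-] /asboolP[y Ky <-]; apply/asboolP.
      by exists (x / y); [apply: KM => //; exact: KV|rewrite gmulfF].
    move=> x xs; apply/asboolP; exists (Sub x (sH x xs)); last by rewrite SubK.
    by apply: sK; rewrite mem_pmap_sub SubK.
  apply/seteqP; split=> // x _.
  by have /asboolP[y Ky /val_inj <-] := HK' _ (valP x).
have [|phi phiM phi_surj] := conradian_character ltSG conrad s'_gen (x0 := Sub h hH).
  by rewrite -(inj_eq val_inj) SubK gmulf1.
have insubdH x : x \in H -> val (insubd (1 : S) x) = x by exact: insubdK.
exists (fun x => phi (insubd (1 : S) x)).
  move=> x y xH yH; rewrite -phiM; congr phi; apply: val_inj.
  have xyH : x * y \in H by exact: (group_closedM H_group).
  by rewrite gmulfM insubdH//= !insubdH.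
by move=> n; have [x <-] := phi_surj n; exists (val x); rewrite ?valKd//; exact: valP.
Qed.
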